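(* Let $d\ge1$. Consider the Matérn covariance family $$\rho(\boldsymbol{x})=\kappa(\|\boldsymbol{x}\|_2/\lambda),\qquad \kappa(r)=\sigma^2\,\frac{2^{1-\nu}}{\Gamma(\nu)}\,(\sqrt{2\nu}\,r)^{\nu}K_\nu(\sqrt{2\nu}\,r),\qquad \boldsymbol{x}\in\mathbb{R}^d,$$ with variance $\sigma^2>0$, smoothness parameter $\nu$ satisfying $1/2\le\nu<\infty$ and correlation length $0<\lambda\le1$. Suppose $h_0/\lambda\le e^{-1}$. Then there exist positive constants $C_1$ and $C_2\ge2\sqrt2$, which may depend on the dimension $d$ but are independent of the other parameters $\ell,h_0,\lambda,\nu,\sigma^2$, such that $R^{\rm ext}$ is positive definite if $$\ell/\lambda\ \ge\ C_1+C_2\,\nu^{1/2}\log\left(\max\{\lambda/h_0,\ \nu^{1/2}\}\right).$$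
   Context: $\Gamma$ is the gamma function and $K_\nu$ the modified Bessel function of the second kind; $\kappa(0)$ is understood as the limit $\sigma^2$. Setting: $m_0\ge1$ is an integer, $h_0=1/m_0$, $m\ge m_0$ is an integer and $\ell=mh_0\ge1$. Let $\varphi:\mathbb{R}\to\mathbb{R}$ be the $2\ell$-periodic function with $\varphi(x)=x$ for $0\le x\le\ell$ and $\varphi(x)=2\ell-x$ for $\ell\le x<2\ell$, and let $\rho^{\rm ext}(\boldsymbol{x})=\rho(\varphi(x_1),\ldots,\varphi(x_d))$. Then $R^{\rm ext}$ is the $s\times s$ matrix, $s=(2m)^d$, with rows and columns indexed by $\{0,\ldots,2m-1\}^d$ and entries $R^{\rm ext}_{\boldsymbol{k},\boldsymbol{k}'}=\rho^{\rm ext}(h_0(\boldsymbol{k}-\boldsymbol{k}'))$. *)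

(* Defs.v *)
From HB Require Import structures.
From mathcomp Require Import all_boot all_order all_algebra.
From mathcomp Require Import all_classical all_reals all_analysis.

Set Implicit Arguments.
Unset Strict Implicit.
Unset Printing Implicit Defensive.

Import Order.TTheory GRing.Theory Num.Theory.
Import numFieldNormedType.Exports.

Local Open Scope classical_set_scope.
Local Open Scope ring_scope.

(* Euler's integral; meaningful for 0 < z. *)
Definition Gamma {R : realType} (z : R) : R :=
  \int[@lebesgue_measure R]_(t in `]0, +oo[) (t `^ (z - 1) * expR (- t)).

Definition cosh {R : realType} (x : R) : R := (expR x + expR (- x)) / 2.

(* K_nu(x), through the integral representation
     K_nu(x) = \int_0^oo exp(- x cosh t) cosh(nu t) dt,
   valid for 0 < x and every real order nu, integer or not
   (DLMF 10.32.9; Watson, Theory of Bessel Functions, 6.22). *)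
Definition besselK {R : realType} (nu x : R) : R :=
  \int[@lebesgue_measure R]_(t in `[0, +oo[)
    (expR (- (x * cosh t)) * cosh (nu * t)).

(* The closed formula is singular at r = 0, where kappa takes its limit
   value sigma^2. *)
Definition kappa {R : realType} (sigma nu r : R) : R :=
  if r == 0 then sigma ^+ 2
  else sigma ^+ 2 * (2 `^ (1 - nu) / Gamma nu)
       * (Num.sqrt (2 * nu) * r) `^ nu * besselK nu (Num.sqrt (2 * nu) * r).

(* The library's norm on 'rV[R]_d is the sup norm, hence this definition. *)
Definition norm2 {R : realType} {d : nat} (x : 'rV[R]_d) : R :=
  Num.sqrt (\sum_(i < d) x 0 i ^+ 2).

Definition rho {R : realType} {d : nat} (sigma nu lambda : R) (x : 'rV[R]_d)
    : R :=
  kappa sigma nu (norm2 x / lambda).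

(* y is the representative of x modulo 2l in [0, 2l[. *)
Definition phi {R : realType} (l x : R) : R :=
  let y := x - (Num.floor (x / (2 * l)))%:~R * (2 * l) in
  if y <= l then y else 2 * l - y.

Lemma phi_periodic {R : realType} (l : R) : 0 < l -> periodic (phi l) (2 * l).
Proof.
move=> l0 x; have l2 : 2 * l != 0 by rewrite mulf_neq0 ?lt0r_neq0.
rewrite /phi (mulrDl x (2 * l) (2 * l)^-1) divff // floorDrz ?rpred1 // floor1 intrD (mulrDl _ 1 (2 * l)) mul1r.
by rewrite opprD addrACA subrr addr0.
Qed.

Lemma phi_left {R : realType} (l x : R) : 0 < l -> 0 <= x <= l -> phi l x = x.
Proof.
move=> l0 /andP[x0 xl]; have l2 : 0 < 2 * l by rewrite mulr_gt0.
have -> : phi l x = if x <= l then x else 2 * l - x; last by rewrite xl.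
rewrite /phi (_ : Num.floor _ = 0) ?mul0r ?subr0 //.
apply/floor_def; rewrite add0r divr_ge0 ?(ltW l2) //=.
by rewrite ltr_pdivrMr // mul1r (le_lt_trans xl) // mulrDl mul1r ltrDl.
Qed.

Lemma phi_right {R : realType} (l x : R) :
  0 < l -> l <= x < 2 * l -> phi l x = 2 * l - x.
Proof.
move=> l0 /andP[lx xl]; have l2 : 0 < 2 * l by rewrite mulr_gt0.
rewrite /phi (_ : Num.floor _ = 0) ?mul0r ?subr0.
  case: ifPn => // xl'; have -> : x = l by apply/eqP; rewrite eq_le xl' lx.
  by rewrite mulrDl mul1r addrK.
apply/floor_def; rewrite add0r divr_ge0 ?(ltW l2) ?(le_trans (ltW l0)) //=.
by rewrite ltr_pdivrMr // mul1r.
Qed.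

Definition rho_ext {R : realType} {d : nat} (l sigma nu lambda : R)
    (x : 'rV[R]_d) : R :=
  rho sigma nu lambda (\row_i phi l (x 0 i)).

(* The multi-indices {0, ..., 2m-1}^d. *)
Notation multi_index d m := {ffun 'I_d -> 'I_(2 * m)}.

Lemma card_multi_index (d m : nat) : #|multi_index d m| = ((2 * m) ^ d)%N.
Proof. by rewrite card_ffun !card_ord. Qed.

(* Rows and columns are numbered by the enumeration of the multi-indices;
   positive definiteness does not depend on the choice of the enumeration. *)
Definition R_ext {R : realType} (d m : nat) (h0 l sigma nu lambda : R)
    : 'M[R]_#|multi_index d m| :=
  \matrix_(a, b)
    let k : multi_index d m := enum_val a in
    let k' : multi_index d m := enum_val b in
    rho_ext l sigma nu lambda
      (h0 *: \row_(i < d) ((k i)%:R - (k' i)%:R)).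

Definition posdefmx {R : realType} {n : nat} (A : 'M[R]_n) : Prop :=
  A^T = A /\ forall v : 'cV[R]_n, v != 0 -> 0 < (v^T *m A *m v) 0 0.

(* Main.v *)
Require Import Defs.
From HB Require Import structures.
From mathcomp Require Import all_boot all_order all_algebra.
From mathcomp Require Import all_classical all_reals all_analysis.
From mathcomp Require Import measurable_realfun.
From mathcomp Require Import zify ring lra.
Import Order.TTheory GRing.Theory Num.Theory.
Import numFieldNormedType.Exports.
Set Implicit Arguments.
Unset Strict Implicit.
Unset Printing Implicit Defensive.
Local Open Scope ring_scope.

(** The Matern covariance is a Gamma mixture of Gaussians: substituting
    t = (z/2) e^u in the integral for K_nu gives, for z > 0,
      2^(1-nu) z^nu K_nu(z)
        = \int_0^oo t^(nu-1) exp(-t - z^2/(4t)) dt,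
    and at z = 0 the right-hand side is Gamma(nu). A Gaussian is a product over
    the coordinates, and phi turns h0(k - k') into h0 times the distance of k
    and k' on the cycle of length 2m. Hence, up to the factor sigma^2/Gamma(nu),
      v^T R_ext v = \int_0^oo t^(nu-1) e^(-t) Q_(A/t)(v) dt,
      A = nu h0^2 / (2 lambda^2),
    where Q_a is the quadratic form of the d-fold tensor power of the circulant
    matrix with entries exp(-a dist(k,k')^2) (lemma quad_form_integral).

    Two bounds on Q_a replace Fourier analysis.
    - If a >= 6d the off-diagonal row sums are at most 1/2, so that
      Q_a(v) >= |v|^2/2 by diagonal dominance (gauss_form_ge_half). This
      covers t <= T with T = A/(6d), of total weight about T^nu, which for fixed
      nu is of order (h0/lambda)^(2 nu).
    - For every a, Q_a(v) >= -d (4m) (2m)^d exp(-a m^2) |v|^2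
      (gauss_form_ge). On the integers a Gaussian is a Gram kernel, being the
      convolution square of a narrower one; on the cycle this identity fails
      only through terms involving a half turn, of size exp(-a m^2).
    The weight e^(-t) exp(-A m^2/t) of the negative part is at most
    e^(-t/2) exp(-sqrt(nu) l/lambda), by the arithmetic-geometric mean inequality.
    The positive contribution wins as soon as sqrt(nu) l/lambda exceeds a multiple
    of nu log(lambda/h0), up to constants depending on d and a term
    (d+1) log(l/lambda) which is absorbed by l/lambda (gauss_mixture_gt0,
    threshold_ineq). *)

(** * Distances on a cycle *)

Definition cdist (n a b : nat) : nat :=
  minn ((a - b) + (b - a)) (n - ((a - b) + (b - a))).

Lemma cdistC n a b : cdist n a b = cdist n b a.
Proof. by rewrite /cdist addnC. Qed.

Lemma cdistP (n a b : nat) : (a < n -> b < n -> 2 * cdist n a b <= n /\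
  ((a + cdist n a b = b \/ b + cdist n a b = a) \/
   (a + cdist n a b = b + n \/ b + cdist n a b = a + n)))%N.
Proof. by move=> an bn; rewrite /cdist; split; lia. Qed.

(** If z is at distance q from both a and b, on opposite sides, then as long as j
    stays within reach the distances from j to a and to b are those of a
    line, |Z - q| and Z + q. Otherwise j lies in the arc opposite to z, far
    from z and, on average, from a and b. *)
Lemma cdist_symmetric_pair (m a b z q j : nat) :
  (a < 4 * m -> b < 4 * m -> z < 4 * m -> j < 4 * m -> q <= m ->
   a + q = z \/ a + q = z + 4 * m -> b = z + q \/ b + 4 * m = z + q ->
   let A := cdist (4 * m) a j in let B := cdist (4 * m) b j in
   let Z := cdist (4 * m) z j in
   (((A = q + Z /\ (B + q = Z \/ B + Z = q)) \/
     (B = q + Z /\ (A + q = Z \/ A + Z = q))) \/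
     (2 * m <= A + B /\ m <= Z)))%N.
Proof.
move=> am bm zm jm qm aq bq /=.
have [] := cdistP am jm; have [] := cdistP bm jm; have [] := cdistP zm jm.
set A := cdist _ a j; set B := cdist _ b j; set Z := cdist _ z j.
move: A B Z => A B Z hZ eZ hB eB hA eA.
by case: aq => ?; case: bq => ?; case: eZ => [[] ?|[] ?]; case: eB => [[] ?|[] ?];
  case: eA => [[] ?|[] ?]; lia.
Qed.

(** On the line A^2 + B^2 = 2 q^2 + 2 Z^2 is the parallelogram law for the median
    from j to the midpoint z of the segment joining 2k and 2k'. Positions are
    doubled, on a cycle of length 4m, so that z is an integer. *)
Lemma cdist_midpoint (m k k' : nat) :
  (k < 2 * m -> k' < 2 * m ->
   exists2 z, z < 4 * m & forall j, j < 4 * m ->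
    let A := cdist (4 * m) (2 * k) j in let B := cdist (4 * m) (2 * k') j in
    let q := cdist (2 * m) k k' in let Z := cdist (4 * m) z j in
    (A ^ 2 + B ^ 2 = 2 * q ^ 2 + 2 * Z ^ 2) \/
    (2 * m ^ 2 <= A ^ 2 + B ^ 2 /\ 2 * m ^ 2 <= 2 * q ^ 2 + 2 * Z ^ 2))%N.
Proof.
wlog kk' : k k' / (k <= k')%N => [H|] km km'.
  have [kk'|k'k] := leqP k k'; first exact: H.
  have [z zm zP] := H _ _ (ltnW k'k) km' km; exists z => // j jm.
  by have /= := zP j jm; rewrite [cdist _ k k']cdistC addnC.
(* The midpoint of the shorter of the two arcs between 2k and 2k'. *)
have [z zm zP] : exists2 z, (z < 4 * m)%N & let q := cdist (2 * m) k k' in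
    (2 * k + q = z /\ 2 * k' = z + q \/
     2 * k' + q = z /\ (2 * k = z + q \/ 2 * k + 4 * m = z + q) \/
     2 * k' + q = z + 4 * m /\ 2 * k = z + q)%N.
  have [h|h] := leqP (k' - k) m; first by exists (k + k')%N; rewrite /cdist; lia.
  have [h'|h'] := ltnP (k + k') (2 * m).
    by exists (k + k' + 2 * m)%N; rewrite /cdist; lia.
  by exists (k + k' - 2 * m)%N; rewrite /cdist; lia.
exists z => // j jm /=.
have qm : (cdist (2 * m) k k' <= m)%N by rewrite /cdist; lia.
set A := cdist _ (2 * k) j; set B := cdist _ (2 * k') j.
set Z := cdist _ z j; set q := cdist _ k k'.
have ABZ : (((A = q + Z /\ (B + q = Z \/ B + Z = q)) \/
     (B = q + Z /\ (A + q = Z \/ A + Z = q))) \/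
     (2 * m <= A + B /\ m <= Z))%N.
  have k4 : (2 * k < 4 * m)%N by lia.
  have k4' : (2 * k' < 4 * m)%N by lia.
  have H1 := @cdist_symmetric_pair m _ _ z q j k4 k4' zm jm qm.
  have H2 := @cdist_symmetric_pair m _ _ z q j k4' k4 zm jm qm.
  have [[e1 e2]|[[e1 e2]|[e1 e2]]] := zP.
  - by apply: H1; left.
  - have := H2 (or_introl e1) e2; rewrite -/A -/B -/Z /= (addnC B A); tauto.
  - have := H2 (or_intror e1) (or_introl e2); rewrite -/A -/B -/Z /= (addnC B A); tauto.
move: ABZ; move: A B Z @q {qm zP} => A B Z q.
move=> [[[-> [<-|<-]]|[-> [<-|<-]]]|[AB mZ]].
- by left; ring.
- by left; ring.
- by left; ring.
- by left; ring.
- right; have := leq_mul AB AB; have := leq_mul mZ mZ.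
  have := (nat_Cauchy A B).1; rewrite -!mulnn; nia.
Qed.

Lemma sum_cdist_shift (V : nmodType) (n z : nat) (f : nat -> V) : (z < n)%N ->
  \sum_(j < n) f (cdist n z j) = \sum_(j < n) f (cdist n 0 j).
Proof.
case: n => // n zn.
rewrite (reindex_inj (addrI (Ordinal zn))) /=; apply: eq_bigr => j _; congr f.
have jn := ltn_ord j.
have [h|h] := ltnP (z + j) n.+1; first by rewrite modn_small // /cdist; lia.
have -> : ((z + j) %% n.+1 = z + j - n.+1)%N.
  by rewrite -{1}(subnK h) modnDr modn_small //; lia.
by rewrite /cdist; lia.
Qed.

(** * Quadratic forms of tensor powers of cyclic Gaussians *)

Section KernelForms.
Variable R : realType.
Implicit Type T : finType.

(** Schur's test; the row-sum bound controls the whole form because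
    |w_k w_k'| <= (w_k^2 + w_k'^2)/2 and E is symmetric. *)
Lemma schur_test T (E : T -> T -> R) (w : T -> R) (s : R) :
  (forall k k', E k k' = E k' k) -> (forall k, \sum_k' `|E k k'| <= s) ->
  `|\sum_k \sum_k' w k * w k' * E k k'| <= s * \sum_k w k ^+ 2.
Proof.
move=> Esym Es.
have -> : s * \sum_k w k ^+ 2 = \sum_k (w k ^+ 2 / 2 * s + w k ^+ 2 / 2 * s).
  by rewrite mulr_sumr; apply: eq_bigr => k _; field.
apply: (@le_trans _ _ (\sum_k \sum_k'
    (w k ^+ 2 / 2 * `|E k k'| + w k' ^+ 2 / 2 * `|E k k'|))).
  apply: le_trans (ler_norm_sum _ _ _) _; apply: ler_sum => k _.
  apply: le_trans (ler_norm_sum _ _ _) _; apply: ler_sum => k' _.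
  rewrite -mulrDl normrM ler_wpM2r // ler_norml.
  have := sqr_ge0 (w k + w k'); have := sqr_ge0 (w k - w k').
  by move=> h1 h2; apply/andP; split; nra.
under eq_bigr do rewrite big_split /=.
rewrite !big_split /= lerD //.
  by apply: ler_sum => k _; rewrite -mulr_sumr ler_wpM2l // divr_ge0 ?sqr_ge0.
rewrite exchange_big /=; apply: ler_sum => k _.
rewrite -mulr_sumr ler_wpM2l ?divr_ge0 ?sqr_ge0 //.
by under eq_bigr do rewrite Esym.
Qed.

(** Expanding the product of sums over i exhibits the tensor product of Gram
    kernels as a Gram kernel. *)
Lemma prod_gram_psd (d n p : nat) (B : 'I_n -> 'I_p -> R)
    (w : {ffun 'I_d -> 'I_n} -> R) :
  0 <= \sum_k \sum_k' w k * w k' * \prod_(i < d) \sum_j B (k i) j * B (k' i) j.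
Proof.
have -> : \sum_k \sum_k' w k * w k' * \prod_(i < d) \sum_j B (k i) j * B (k' i) j
  = \sum_(J : {ffun 'I_d -> 'I_p}) (\sum_k w k * \prod_(i < d) B (k i) (J i)) ^+ 2.
  under eq_bigr => k _ do under eq_bigr => k' _ do
    rewrite bigA_distr_bigA mulr_sumr /=.
  under eq_bigr => k _ do rewrite exchange_big /=.
  rewrite exchange_big /=; apply: eq_bigr => J _.
  rewrite expr2 mulr_suml; apply: eq_bigr => k _.
  rewrite mulr_sumr; apply: eq_bigr => k' _.
  by rewrite big_split /=; ring.
by apply: sumr_ge0 => J _; exact: sqr_ge0.
Qed.

Lemma ler_dist_prod (d : nat) (a b : 'I_d -> R) (e : R) :
  (forall i, `|a i| <= 1) -> (forall i, `|b i| <= 1) ->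
  (forall i, `|a i - b i| <= e) ->
  `|\prod_i a i - \prod_i b i| <= d%:R * e.
Proof.
elim: d a b => [|d IHd] a b a1 b1 ab.
  by rewrite !big_ord0 subrr normr0 mul0r.
rewrite !big_ord_recl /=.
set p := \prod_(i < d) a _; set q := \prod_(i < d) b _.
have p1 : `|p| <= 1 by rewrite normr_prod prodr_ile1 // => i _; rewrite normr_ge0 a1.
have -> : a ord0 * p - b ord0 * q = (a ord0 - b ord0) * p + b ord0 * (p - q).
  by ring.
have h1 : `|(a ord0 - b ord0) * p| <= e.
  by rewrite normrM -[leRHS]mulr1 ler_pM.
have h2 : `|b ord0 * (p - q)| <= d%:R * e.
  by rewrite normrM -[leRHS]mul1r ler_pM // IHd.
rewrite -natr1 [leRHS]mulrDl mul1r [leRHS]addrC.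
by rewrite (le_trans (ler_normD _ _)) // lerD.
Qed.

Definition gauss_kernel (n : nat) (a : R) (x y : nat) : R :=
  expR (- a * (cdist n x y)%:R ^+ 2).

Lemma gauss_kernel_le1 n a x y : 0 <= a -> gauss_kernel n a x y <= 1.
Proof.
by move=> a0; rewrite /gauss_kernel -expR0 ler_expR mulNr oppr_le0 mulr_ge0 ?sqr_ge0.
Qed.

Lemma gauss_kernelC n a x y : gauss_kernel n a x y = gauss_kernel n a y x.
Proof. by rewrite /gauss_kernel cdistC. Qed.

(** The columns of B are Gaussians of half the variance, centred at the points of the
    half-integer grid, which is the cycle of length 4m. By the parallelogram law
    the terms of sum_j B(k,j) B(k',j) agree with those of the Gaussian kernel times
    the normalising constant c = sum_j B(k,j)^2, except for j in the arc opposite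
    to the midpoint of k and k', where both are at most exp(-a m^2). *)
Lemma gauss_gram (m : nat) (a : R) : (0 < m)%N -> 0 <= a ->
  exists B : 'I_(2 * m) -> 'I_(4 * m) -> R,
    (forall k, \sum_j B k j * B k j = 1) /\
    (forall k k', `|\sum_j B k j * B k' j - gauss_kernel (2 * m) a k k'|
       <= (4 * m)%:R * expR (- a * m%:R ^+ 2)).
Proof.
move=> m0 a0.
pose u (x : nat) : R := expR (- (a / 2) * x%:R ^+ 2).
have u2E x y : u x * u y = expR (- (a / 2) * (x ^ 2 + y ^ 2)%:R).
  by rewrite /u -expRD -mulrDr natrD !natrX.
pose c := \sum_(j < 4 * m) u (cdist (4 * m) 0 j) * u (cdist (4 * m) 0 j).
have cE z : (z < 4 * m)%N ->
    \sum_(j < 4 * m) u (cdist (4 * m) z j) * u (cdist (4 * m) z j) = c.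
  by move=> zm; rewrite (sum_cdist_shift (fun x => u x * u x)).
have c1 : 1 <= c.
  have m4 : (0 < 4 * m)%N by rewrite muln_gt0.
  rewrite /c (bigD1 (Ordinal m4)) //= {1 2}/cdist subnn min0n.
  rewrite {1 2}/u expr0n mulr0 expR0 mul1r lerDl sumr_ge0 // => j _.
  by rewrite mulr_ge0 ?expR_ge0.
have c0 : 0 < c by exact: lt_le_trans c1.
have k4 (k : 'I_(2 * m)) : (2 * k < 4 * m)%N by have := ltn_ord k; lia.
exists (fun (k : 'I_(2 * m)) (j : 'I_(4 * m)) =>
  u (cdist (4 * m) (2 * k) j) / Num.sqrt c).
have BB (k k' : 'I_(2 * m)) : \sum_(j < 4 * m) u (cdist (4 * m) (2 * k) j) / Num.sqrt c *
    (u (cdist (4 * m) (2 * k') j) / Num.sqrt c) =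
    (\sum_(j < 4 * m) u (cdist (4 * m) (2 * k) j) * u (cdist (4 * m) (2 * k') j)) / c.
  rewrite mulr_suml; apply: eq_bigr => j _.
  by rewrite mulrACA -invfM -expr2 sqr_sqrtr // ltW.
split=> [k|k k']; first by rewrite BB cE // divff // gt_eqF.
rewrite BB.
have [z zm zP] := cdist_midpoint (ltn_ord k) (ltn_ord k').
rewrite -{1}[gauss_kernel _ _ _ _](mulfK (lt0r_neq0 c0)) -mulrBl normrM normfV.
rewrite (gtr0_norm c0) ler_pdivrMr // -(cE z zm) mulr_sumr -sumrB.
apply: (@le_trans _ _ ((4 * m)%:R * expR (- a * m%:R ^+ 2))); last first.
  by rewrite cE // ler_peMr // mulr_ge0 ?expR_ge0.
apply: le_trans (ler_norm_sum _ _ _) _.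
have -> : (4 * m)%:R * expR (- a * m%:R ^+ 2) =
    \sum_(j < 4 * m) expR (- a * m%:R ^+ 2).
  by rewrite sumr_const card_ord mulr_natl.
apply: ler_sum => j _.
rewrite (u2E (cdist _ (2 * k) j)) (u2E (cdist _ z j)) /gauss_kernel -[X in _ - X]expRD.
have -> : - a * (cdist (2 * m) k k')%:R ^+ 2 +
    - (a / 2) * (cdist (4 * m) z j ^ 2 + cdist (4 * m) z j ^ 2)%:R =
  - (a / 2) * (2 * cdist (2 * m) k k' ^ 2 + 2 * cdist (4 * m) z j ^ 2)%:R.
  move: (cdist _ _ _) (cdist _ _ _) => q Z.
  by rewrite -!mulnn !natrD !natrM; field.
have [->|[h1 h2]] := zP j (ltn_ord j); first by rewrite subrr normr0 expR_ge0.
have expR_le x : (2 * m ^ 2 <= x)%N ->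
    expR (- (a / 2) * x%:R) <= expR (- a * m%:R ^+ 2).
  move=> mx; rewrite ler_expR.
  have -> : - a * m%:R ^+ 2 = - (a / 2) * (2 * m ^ 2)%:R.
    by rewrite natrM natrX; field.
  by rewrite ler_wnM2l ?ler_nat // oppr_le0 divr_ge0.
have dist_le (x y M : R) : 0 <= x <= M -> 0 <= y <= M -> `|x - y| <= M.
  by move=> /andP[? ?] /andP[? ?]; rewrite ler_norml; apply/andP; split; lra.
by apply: dist_le; rewrite expR_ge0 expR_le.
Qed.

Definition gauss_form (d m : nat) (a : R) (w : {ffun 'I_d -> 'I_(2 * m)} -> R) : R :=
  \sum_k \sum_k' w k * w k' * \prod_(i < d) gauss_kernel (2 * m) a (k i) (k' i).

(** The form differs by an entrywise small one from the tensor power of the Gram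
    kernel of gauss_gram, whose form is nonnegative. *)
Lemma gauss_form_ge (d m : nat) (a : R) w : (0 < m)%N -> 0 <= a ->
  - (d%:R * ((4 * m)%:R * expR (- a * m%:R ^+ 2)) * ((2 * m) ^ d)%:R
     * \sum_k w k ^+ 2) <= @gauss_form d m a w.
Proof.
move=> m0 a0; have [B [B1 BG]] := gauss_gram m0 a0.
pose P k k' : R := \sum_j B k j * B k' j.
have P1 k k' : `|P k k'| <= 1.
  have -> : (1 : R) = \sum_j (B k j * B k j + B k' j * B k' j) / 2.
    by rewrite -mulr_suml big_split /= !B1; field.
  apply: le_trans (ler_norm_sum _ _ _) _; apply: ler_sum => j _.
  rewrite ler_norml.
  have := sqr_ge0 (B k j + B k' j); have := sqr_ge0 (B k j - B k' j).
  by move=> h1 h2; apply/andP; split; nra.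
have PC k k' : P k k' = P k' k by apply: eq_bigr => j _; rewrite mulrC.
pose E (k k' : {ffun 'I_d -> 'I_(2 * m)}) : R :=
  \prod_(i < d) P (k i) (k' i) -
  \prod_(i < d) gauss_kernel (2 * m) a (k i) (k' i).
have Esym k k' : E k k' = E k' k.
  rewrite /E; congr (_ - _); apply: eq_bigr => i _; first exact: PC.
  by rewrite gauss_kernelC.
have Erow k : \sum_k' `|E k k'| <=
    d%:R * ((4 * m)%:R * expR (- a * m%:R ^+ 2)) * ((2 * m) ^ d)%:R.
  rewrite -card_multi_index -sum1_card natr_sum mulr_sumr.
  apply: ler_sum => k' _; rewrite mulr1; apply: ler_dist_prod => i.
  - exact: P1.
  - by rewrite ger0_norm ?expR_ge0 ?gauss_kernel_le1.
  - exact: BG.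
have := schur_test w Esym Erow; rewrite ler_norml => /andP[_].
have -> : gauss_form a w =
    (\sum_k \sum_k' w k * w k' * \prod_(i < d) P (k i) (k' i)) -
    \sum_k \sum_k' w k * w k' * E k k'.
  rewrite -sumrB; apply: eq_bigr => k _; rewrite -sumrB; apply: eq_bigr => k' _.
  by rewrite /E mulrBr opprB addrC subrK.
by have := prod_gram_psd B w; rewrite -/P; lra.
Qed.

(** Since x^2 >= x on the integers, both half turns are dominated by a geometric
    series of ratio exp(-a). *)
Lemma sum_gauss_kernel_le (n : nat) (a : R) (k : 'I_n) : 0 < a ->
  \sum_(j < n) gauss_kernel n a k j <= 1 + 2 * (expR (- a) / (1 - expR (- a))).
Proof.
move=> a0; rewrite /gauss_kernel.
rewrite (sum_cdist_shift (fun x => expR (- a * x%:R ^+ 2)) (ltn_ord k)).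
case: n k => [[] //|n] _.
set q := expR (- a).
have q0 : 0 <= q by exact: expR_ge0.
have q1 : q < 1 by rewrite -expR0 ltr_expR oppr_lt0.
have qX x : q ^+ x = expR (- a * x%:R) by rewrite -expRM_natr.
have geo : \sum_(j < n) q ^+ j.+1 <= q / (1 - q).
  under eq_bigr do rewrite exprS.
  rewrite -mulr_sumr ler_wpM2l // -[leRHS]mul1r ler_pdivlMr ?subr_gt0 //.
  have := subrX1 q n; have := exprn_ge0 n q0; lra.
have q_le (x y : nat) : (x <= y)%N -> expR (- a * y%:R ^+ 2) <= q ^+ x.
  move=> xy; rewrite qX ler_expR ler_wnM2l ?oppr_le0 ?(ltW a0) //.
  by rewrite -natrX ler_nat (leq_trans xy) // -mulnn; case: (y) => // z; exact: leq_pmulr.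
rewrite big_ord_recl /cdist /= !subnn min0n expr0n mulr0 expR0 lerD2l.
apply: (@le_trans _ _ (\sum_(j < n) (q ^+ j.+1 + q ^+ (n - j.+1).+1))).
  apply: ler_sum => j _; have jn := ltn_ord j; rewrite /bump /= add1n.
  have [h|h] := leqP j.+1 (n - j).
    by rewrite (le_trans (q_le j.+1 _ _)) ?lerDl ?exprn_ge0 //; lia.
  by rewrite (le_trans (q_le (n - j.+1).+1 _ _)) ?lerDr ?exprn_ge0 //; lia.
rewrite big_split /= mulr2n mulrDl mul1r lerD //.
rewrite (reindex_inj rev_ord_inj) /=; apply: le_trans geo.
apply: ler_sum => j _; have jn := ltn_ord j.
by have -> : ((n - (n - j.+1).+1).+1 = j.+1)%N by lia.
Qed.

(** For a >= 6d each one-dimensional row sum is at most 1 + 1/(3d), so a row sum of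
    the tensor power is at most e^(1/3) <= 3/2, of which 1 is on the diagonal. *)
Lemma gauss_form_ge_half (d m : nat) (a : R) w : (0 < d)%N ->
  (6 * d)%:R <= a -> (\sum_k w k ^+ 2) / 2 <= @gauss_form d m a w.
Proof.
move=> d0 da.
have dR : (1 : R) <= d%:R by rewrite ler1n.
have a0 : 0 < a by apply: lt_le_trans da; rewrite ltr0n muln_gt0.
pose K (k k' : {ffun 'I_d -> 'I_(2 * m)}) : R :=
  \prod_(i < d) gauss_kernel (2 * m) a (k i) (k' i).
have K0 k k' : 0 <= K k k' by apply: prodr_ge0 => i _; exact: expR_ge0.
have Kdiag k : K k k = 1.
  rewrite /K big1 // => i _.
  by rewrite /gauss_kernel /cdist subnn min0n expr0n mulr0 expR0.
pose E k k' : R := if k == k' then 0 else K k k'.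
have Esym k k' : E k k' = E k' k.
  rewrite /E eq_sym; case: eqP => // _; apply: eq_bigr => i _.
  by rewrite gauss_kernelC.
have q_le : 2 * (expR (- a) / (1 - expR (- a))) <= (3 * d%:R)^-1.
  have e1 : expR (- a) * (6 * d%:R + 1) <= 1.
    rewrite expRN mulrC ler_pdivrMr ?expR_gt0 // mul1r.
    apply: le_trans (expR_ge1Dx a); rewrite addrC lerD2l.
    by move: da; rewrite natrM.
  have e2 : 0 < expR (- a) by exact: expR_gt0.
  have e3 : 0 < 1 - expR (- a) by nra.
  rewrite mulrA ler_pdivrMr // ler_pdivlMl; nra.
have Krow k : \sum_k' K k k' <= 3 / 2.
  rewrite /K -(bigA_distr_bigA (fun (i : 'I_d) (j : 'I_(2 * m)) =>
    gauss_kernel (2 * m) a (k i) j)) /=.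
  apply: (@le_trans _ _ (\prod_(i < d) expR (3 * d%:R)^-1)).
    apply: ler_prod => i _; apply/andP; split.
      by apply: sumr_ge0 => j _; exact: expR_ge0.
    apply: le_trans (sum_gauss_kernel_le (k i) a0) _.
    by apply: le_trans (expR_ge1Dx _); rewrite lerD2l.
  rewrite prodr_const card_ord -expRM_natr.
  have -> : (3 * d%:R)^-1 * d%:R = 3^-1 :> R.
    by rewrite invfM mulfVK // gt_eqF // (lt_le_trans ltr01).
  have := expR_ge1Dx (- 3^-1 : R).
  by rewrite expRN -(ler_pM2r (expR_gt0 3^-1)) mulVf ?gt_eqF ?expR_gt0 //; lra.
have Erow k : \sum_k' `|E k k'| <= 1 / 2.
  have -> : \sum_k' `|E k k'| = \sum_k' K k k' - 1.
    rewrite (bigD1 k) //= [in RHS](bigD1 k) //= Kdiag /E eqxx normr0 add0r.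
    rewrite addrAC subrr add0r; apply: eq_bigr => k' /negPf.
    by rewrite eq_sym => ->; rewrite ger0_norm.
  by have := Krow k; lra.
have := schur_test w Esym Erow; rewrite ler_norml => /andP[+ _].
have -> : gauss_form a w =
    \sum_k w k ^+ 2 + \sum_k \sum_k' w k * w k' * E k k'.
  rewrite -big_split /=; apply: eq_bigr => k _.
  rewrite (bigD1 k) //= [in RHS](bigD1 k) //= -/(K k k) Kdiag /E eqxx mulr1 mulr0.
  rewrite add0r expr2; congr (_ + _); apply: eq_bigr => k' /negPf.
  by rewrite eq_sym => ->.
lra.
Qed.

End KernelForms.

(** * Exponential substitution on the positive half-line *)

Section LogSubstitution.
Local Open Scope classical_set_scope.
Variable R : realType.
Notation mu := (@lebesgue_measure R).
Implicit Types (f : R -> R) (a u : R).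

Lemma derive1_Mexp a : (fun u => a * expR u)^`() = (fun u => a * expR u).
Proof. by apply/funext => z; rewrite derive1E derive_val. Qed.

Lemma continuous_Mexp a : continuous (fun u => a * expR u).
Proof.
by move=> u; apply: continuousM; [exact: cvg_cst|exact: continuous_expR].
Qed.

Lemma measurable_fun_oy f : (forall x, 0 < x -> {for x, continuous f}) ->
  measurable_fun (`]0, +oo[ : set R) f.
Proof.
move=> cf; apply: open_continuous_measurable_fun; first exact: interval_open.
by move=> x; rewrite inE /= in_itv /= andbT => x0; exact: cf.
Qed.

(** The derivative of a e^u has no limit at infinity, so the substitution is made on
    the bounded intervals [-n, n] and followed by monotone convergence. *)
Lemma integral_oy_expR f a : 0 < a ->
  (forall x, 0 < x -> 0 <= f x) -> (forall x, 0 < x -> {for x, continuous f}) ->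
  (\int[mu]_(x in `]0%R, +oo[) (f x)%:E =
   \int[mu]_u (f (a * expR u) * (a * expR u))%:E)%E.
Proof.
move=> a0 f0 cf.
have aexp0 u : 0 < a * expR u by rewrite mulr_gt0 ?expR_gt0.
pose F (n : nat) : set R := `[a * expR (- n%:R), a * expR n%:R].
pose G (n : nat) : set R := `[- n%:R, n%:R].
have FS n : F n `<=` `]0, +oo[.
  move=> x; rewrite /F /= !in_itv /= => /andP[+ _].
  by rewrite andbT; exact: lt_le_trans.
have Fcup : \bigcup_n F n = `]0, +oo[.
  apply/seteqP; split=> [x [n _] /FS //|x]; rewrite /= in_itv /= andbT => x0.
  have [n nP] : exists n : nat, `|ln (x / a)| <= n%:R.
    by exists (Num.bound `|ln (x / a)|); rewrite ltW // archi_boundP.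
  exists n => //; rewrite /F /= in_itv /=.
  have -> : x = a * expR (ln (x / a)).
    by rewrite lnK ?posrE ?divr_gt0 // mulrCA divff ?mulr1 // gt_eqF.
  by move: nP; rewrite ler_norml => /andP[n1 n2]; rewrite !ler_pM2l // !ler_expR n1.
have Gcup : \bigcup_n G n = setT.
  apply/seteqP; split=> // x _; exists (Num.bound `|x|) => //.
  rewrite /G /= in_itv /= -ler_norml.
  by rewrite ltW // archi_boundP.
have Fmono : {homo F : n m / (n <= m)%N >-> (n <= m)%O}.
  move=> n m nm; rewrite subsetEset => x; rewrite /F /= !in_itv /= => /andP[h1 h2].
  apply/andP; split.
    by apply: le_trans h1; rewrite ler_pM2l // ler_expR lerN2 ler_nat.
  by apply: (le_trans h2); rewrite ler_pM2l // ler_expR ler_nat.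
have Gmono : {homo G : n m / (n <= m)%N >-> (n <= m)%O}.
  move=> n m nm; rewrite subsetEset => x; rewrite /G /= !in_itv /= => /andP[h1 h2].
  apply/andP; split.
    by apply: le_trans h1; rewrite lerN2 ler_nat.
  by apply: (le_trans h2); rewrite ler_nat.
have mf : measurable_fun (`]0, +oo[ : set R) f by exact: measurable_fun_oy.
have cg : continuous (fun u => f (a * expR u) * (a * expR u)).
  move=> u; apply: (@continuousM _ R (fun u => f (a * expR u)) (fun u => a * expR u));
    last exact: continuous_Mexp.
  by apply: continuous_comp; [exact: continuous_Mexp|exact: cf].
have FG n : (\int[mu]_(x in F n) (f x)%:E =
             \int[mu]_(u in G n) (f (a * expR u) * (a * expR u))%:E)%E.
  rewrite /F /G (@integration_by_substitution_increasing _ (fun u => a * expR u) f).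
  - by apply: eq_integral => u _; rewrite derive1_Mexp.
  - by rewrite -subr_ge0 opprK addr_ge0.
  - by move=> x y _ _ xy; rewrite ltr_pM2l // ltr_expR.
  - by rewrite derive1_Mexp => x _; exact: continuous_Mexp.
  - rewrite derive1_Mexp; apply/cvg_ex; eexists; apply: cvg_at_right_filter.
    exact: continuous_Mexp.
  - rewrite derive1_Mexp; apply/cvg_ex; eexists; apply: cvg_at_left_filter.
    exact: continuous_Mexp.
  - split=> [x _||].
    + exact: ex_derive.
    + by apply: cvg_at_right_filter; exact: continuous_Mexp.
    + by apply: cvg_at_left_filter; exact: continuous_Mexp.
  - apply: continuous_in_subspaceT => x; rewrite inE /= in_itv /= => /andP[h _].
    by apply: cf; exact: lt_le_trans h.
have cvgF : (\int[mu]_(x in F n) (f x)%:E)%E @[n --> \oo] -->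
    (\int[mu]_(x in `]0%R, +oo[) (f x)%:E)%E.
  rewrite -Fcup; apply: ge0_nondecreasing_set_cvg_integral => //.
  - by move=> n; exact: measurable_itv.
  - move=> n; apply/measurable_EFinP; apply: measurable_funS mf => //.
  - by move=> n x /FS; rewrite /= in_itv /= andbT lee_fin => /f0.
have cvgG : (\int[mu]_(u in G n) (f (a * expR u) * (a * expR u))%:E)%E @[n --> \oo] -->
    (\int[mu]_u (f (a * expR u) * (a * expR u))%:E)%E.
  rewrite -Gcup; apply: ge0_nondecreasing_set_cvg_integral => //.
  - by move=> n; exact: measurable_itv.
  - move=> n; apply/measurable_EFinP; apply: measurable_funTS.
    exact: continuous_measurable_fun.
  - by move=> n x _; rewrite lee_fin mulr_ge0 ?f0 ?ltW.
have e : (fun n => \int[mu]_(x in F n) (f x)%:E)%E =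
    (fun n => \int[mu]_(u in G n) (f (a * expR u) * (a * expR u))%:E)%E.
  by apply/funext => n; exact: FG.
rewrite e in cvgF.
by rewrite -(cvg_lim _ cvgF) // -(cvg_lim _ cvgG).
Qed.

(** Folding u and -u together matches the half-line integral defining K_nu. *)
Lemma integral_oy_fold f a : 0 < a ->
  (forall x, 0 < x -> 0 <= f x) -> (forall x, 0 < x -> {for x, continuous f}) ->
  (\int[mu]_(x in `]0%R, +oo[) (f x)%:E =
   \int[mu]_(u in `[0%R, +oo[) (f (a * expR u) * (a * expR u) +
      f (a * expR (- u)) * (a * expR (- u)))%:E)%E.
Proof.
move=> a0 f0 cf; rewrite (integral_oy_expR a0 f0 cf).
set g := fun u => f (a * expR u) * (a * expR u).
have aexp0 u : 0 < a * expR u by rewrite mulr_gt0 ?expR_gt0.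
have cg : continuous g.
  move=> u; apply: (@continuousM _ R (fun u => f (a * expR u)) (fun u => a * expR u));
    last exact: continuous_Mexp.
  by apply: continuous_comp; [exact: continuous_Mexp|exact: cf].
have mg : measurable_fun setT g by exact: continuous_measurable_fun.
have mgN : measurable_fun setT (g \o -%R).
  by apply: measurableT_comp => //; exact: measurable_oppr.
have g0 u : 0 <= g u by rewrite mulr_ge0 ?f0 ?ltW.
under [RHS]eq_integral do rewrite EFinD.
rewrite ge0_integralD //; last 4 first.
- by move=> u _; rewrite lee_fin; exact: g0.
- by apply/measurable_EFinP; exact: measurable_funTS.
- by move=> u _; rewrite lee_fin; exact: (g0 (- u)).
- by apply/measurable_EFinP; exact: (@measurable_funTS _ _ _ _ _ (g \o -%R)).
have -> : (\int[mu]_(u in `[0%R, +oo[) (f (a * expR (- u)) * (a * expR (- u)))%:E =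
  \int[mu]_(u in `]-oo, 0%R]) (g u)%:E)%E.
  rewrite (@ge0_integration_by_substitution0 _ (fun u => (g (- u))%:E)) //.
  - by apply: eq_integral => u _; rewrite opprK.
  - exact/measurable_EFinP.
  - by move=> u; rewrite lee_fin.
rewrite -integral_itv_obnd_cbnd; last by apply/measurable_EFinP; exact: measurable_funTS.
rewrite addeC -ge0_integral_setU //=.
- by rewrite -setCitvr setvU.
- by rewrite -setCitvr setvU; exact/measurable_EFinP.
- by move=> x _; rewrite lee_fin.
- rewrite disj_set2E; apply/eqP; rewrite -subset0 => x/=.
  by rewrite !in_itv/= andbT ltNge => -[? /negP].
Qed.

End LogSubstitution.

(** * The Matern covariance as a mixture of Gaussians *)

Section MaternMixture.
Local Open Scope classical_set_scope.
Variable R : realType.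
Notation mu := (@lebesgue_measure R).
Implicit Types (nu c t u : R).

Lemma measurable_expRM (b : R) (D : set R) :
  measurable_fun D (fun t => (expR (b * t))%:E).
Proof.
apply/measurable_EFinP; apply: measurable_funTS; apply: continuous_measurable_fun.
move=> x; apply: continuous_comp; last exact: continuous_expR.
by apply: continuousM; [exact: cvg_cst|exact: cvg_id].
Qed.

Lemma integral_expRN (b : R) : 0 < b ->
  (\int[mu]_(t in `[0%R, +oo[) (expR (- b * t))%:E = (b^-1)%:E)%E.
Proof.
move=> b0.
have : (\int[mu]_(t in `[0%R, +oo[) (b%:E * (expR (- b * t))%:E) = 1)%E.
  rewrite -(integral_exponential_pdf b0) integral_mkcond; apply: eq_integral => x _.
  by rewrite /exponential_pdf /patch; case: ifP.
have mexp := @measurable_expRM (- b) `[0, +oo[.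
rewrite ge0_integralZl_EFin ?(ltW b0) //.
case: (\int[mu]_(t in _) _)%E => [r| |].
- rewrite -EFinM => -[br]; congr EFin.
  by rewrite -[r](mulKf (lt0r_neq0 b0)) br mulr1.
- by rewrite gt0_muley // lte_fin.
- by rewrite gt0_muleNy // lte_fin.
Qed.

(** The density t^(nu-1) exp(-t - c/t) on t > 0, written with a logarithm so that
    powers, products and substitutions all become computations on exponents. *)
Definition gamma_weight nu c t : R := expR ((nu - 1) * ln t - t - c / t).

Lemma gamma_weight_ge0 nu c t : 0 <= gamma_weight nu c t.
Proof. exact: expR_ge0. Qed.

Lemma continuous_gamma_weight nu c t : 0 < t ->
  {for t, continuous (gamma_weight nu c)}.
Proof.
move=> t0; apply: continuous_comp; last exact: continuous_expR.
apply: continuousB.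
  apply: continuousB; last exact: cvg_id.
  by apply: continuousM; [exact: cvg_cst|exact: continuous_ln].
apply: continuousM; first exact: cvg_cst.
by apply: cvgV; [exact: lt0r_neq0|exact: cvg_id].
Qed.

Lemma gamma_weight_exp nu c u :
  gamma_weight nu c (expR u) * expR u =
  expR (nu * u - expR u - c * expR (- u)).
Proof.
by rewrite /gamma_weight expRK -expRN -expRD; congr expR; ring.
Qed.

(** After the substitution t = e^u, folded, the two summands are
    exp(nu u - e^u) <= K exp(-u) and exp(-nu u - e^(-u)) <= exp(-nu u). *)
Lemma integral_gamma_weight_lty nu : 0 < nu ->
  (\int[mu]_(t in `]0%R, +oo[) (gamma_weight nu 0 t)%:E < +oo)%E.
Proof.
move=> nu0.
rewrite (integral_oy_fold (@ltr01 R)) => [|t _|t]; first last.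
- exact: continuous_gamma_weight.
- exact: gamma_weight_ge0.
pose p := nu + 1; have p0 : 0 < p by rewrite addr_gt0.
pose K := expR (p * ln p - p).
have mexp (b : R) (D : set R) := @measurable_expRM (- b) D.
pose h u := expR (nu * u - expR u).
have mh : measurable_fun [set: R] h.
  apply: continuous_measurable_fun => x.
  apply: continuous_comp; last exact: continuous_expR.
  apply: continuousB; last exact: continuous_expR.
  by apply: continuousM; [exact: cvg_cst|exact: cvg_id].
under eq_integral => u _.
  rewrite !mul1r !gamma_weight_exp !mul0r !subr0 -/(h u) -/(h (- u)).
  over.
apply: (@le_lt_trans _ _ (\int[mu]_(u in `[0%R, +oo[)
    (K%:E * (expR (- 1 * u))%:E + (expR (- nu * u))%:E))%E).
  apply: ge0_le_integral => //.
  - by move=> u _; rewrite lee_fin addr_ge0 ?expR_ge0.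
  - apply/measurable_EFinP; apply: measurable_funTS; apply: measurable_funD => //.
    by apply: measurableT_comp => //; exact: measurable_oppr.
  - by apply: emeasurable_funD; [apply: measurable_funeM|]; exact: mexp.
  - move=> u; rewrite /= in_itv /= andbT => u0.
    rewrite -EFinM -EFinD lee_fin lerD //.
      (* The tangent of exp at ln p bounds p u - e^u by its maximum. *)
      rewrite /K -expRD ler_expR.
      have := expR_ge1Dx (u - ln p); rewrite expRD expRN lnK ?posrE //.
      rewrite ler_pdivlMr // /p; lra.
    by rewrite ler_expR; have := expR_ge0 (- u); lra.
have mKexp : measurable_fun (`[0%R, +oo[ : set R) (fun u => K%:E * (expR (- 1 * u))%:E)%E.
  by apply: measurable_funeM; exact: mexp.
have exp0 b u : (0 <= (expR (- b * u))%:E)%E by rewrite lee_fin expR_ge0.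
have Kexp0 u : (0 <= K%:E * (expR (- 1 * u))%:E)%E.
  by rewrite mule_ge0 // lee_fin expR_ge0.
rewrite ge0_integralD //; last exact: mexp.
rewrite ge0_integralZl_EFin ?expR_ge0 //; last exact: mexp.
by rewrite !integral_expRN // -EFinM -EFinD ltry.
Qed.

Lemma integrable_gamma_weight nu c : 0 < nu -> 0 <= c ->
  mu.-integrable `]0, +oo[ (EFin \o gamma_weight nu c).
Proof.
move=> nu0 c0.
have mw c' : measurable_fun (`]0, +oo[ : set R) (EFin \o gamma_weight nu c').
  apply/measurable_EFinP; apply: measurable_fun_oy => x x0.
  exact: continuous_gamma_weight.
have w0 : mu.-integrable `]0, +oo[ (EFin \o gamma_weight nu 0).
  apply/integrableP; split; first exact: mw.
  apply: le_lt_trans (integral_gamma_weight_lty nu0).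
  rewrite le_eqVlt; apply/orP; left; apply/eqP; apply: eq_integral => t _.
  by rewrite /= ger0_norm ?gamma_weight_ge0.
apply: le_integrable w0 => //; first exact: mw.
move=> t; rewrite /= in_itv /= andbT => t0.
rewrite !ger0_norm ?gamma_weight_ge0 // lee_fin ler_expR mul0r subr0.
by rewrite gerBl divr_ge0 // ltW.
Qed.

Lemma fine_pmulEFin (c : R) (x : \bar R) : 0 < c ->
  fine (c%:E * x)%E = c * fine x.
Proof.
by move=> c0; case: x => [r| |] //=; rewrite ?gt0_muley ?gt0_muleNy ?lte_fin // mulr0.
Qed.

Lemma Gamma_weightE nu :
  Gamma nu = \int[mu]_(t in `]0, +oo[) gamma_weight nu 0 t.
Proof.
apply: eq_Rintegral => t; rewrite inE /= in_itv /= andbT => t0.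
by rewrite /gamma_weight /powR gt_eqF // -expRD mul0r subr0.
Qed.

(** With t = (x/2) e^u one has t + (x^2/4)/t = x cosh u, and folding turns e^(nu u)
    into 2 cosh(nu u). *)
Lemma besselK_weightE nu x : 0 < x ->
  2 `^ (1 - nu) * x `^ nu * besselK nu x =
  \int[mu]_(t in `]0, +oo[) gamma_weight nu (x ^+ 2 / 4) t.
Proof.
move=> x0; have x20 : 0 < x / 2 by rewrite divr_gt0.
rewrite [RHS]/Rintegral (integral_oy_fold x20) => [|t _|t]; first last.
- exact: continuous_gamma_weight.
- exact: gamma_weight_ge0.
pose s := ln (x / 2); have es : x / 2 = expR s by rewrite /s lnK.
have wE u : gamma_weight nu (x ^+ 2 / 4) (expR (s + u)) * expR (s + u) =
    expR (nu * s) * (expR (- (x * cosh u)) * expR (nu * u)).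
  rewrite gamma_weight_exp -!expRD; congr expR.
  have -> : x ^+ 2 / 4 = expR s * expR s by rewrite -es; field.
  have -> : x = 2 * expR s by rewrite -es; field.
  have E0 : expR s != 0 by rewrite gt_eqF ?expR_gt0.
  have U0 : expR u != 0 by rewrite gt_eqF ?expR_gt0.
  by rewrite /cosh opprD !expRD !expRN; field; rewrite E0 U0.
have coshN u : cosh (- u) = cosh u by rewrite /cosh opprK [in LHS]addrC.
have foldE u : gamma_weight nu (x ^+ 2 / 4) (expR s * expR u) * (expR s * expR u) +
    gamma_weight nu (x ^+ 2 / 4) (expR s * expR (- u)) * (expR s * expR (- u)) =
    (2 * expR (nu * s)) * (expR (- (x * cosh u)) * cosh (nu * u)).
  rewrite -(expRD s u) -(expRD s (- u)) (wE u) (wE (- u)) (coshN u) mulrN.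
  rewrite [cosh (nu * u)]/cosh.
  move: (expR (nu * s)) (expR (- (x * _))) (expR (nu * u)) (expR (- (nu * u))).
  by move=> A P V W; field.
rewrite es; under eq_integral => u _ do rewrite foldE EFinM.
have c0 : 0 < 2 * expR (nu * s) by rewrite mulr_gt0 ?expR_gt0.
have mb : measurable_fun (`[0%R, +oo[ : set R)
    (fun u => (expR (- (x * cosh u)) * cosh (nu * u))%:E).
  have ccosh : continuous (@cosh R).
    move=> u; apply: (@continuousM _ R (fun v => expR v + expR (- v)) (fun=> 2^-1));
      last exact: cvg_cst.
    apply: (@continuousD _ R R expR (fun v => expR (- v))); first exact: continuous_expR.
    by apply: continuous_comp; [exact: continuousN|exact: continuous_expR].
  apply/measurable_EFinP; apply: measurable_funTS; apply: continuous_measurable_fun.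
  move=> u.
  apply: (@continuousM _ R (fun u => expR (- (x * cosh u))) (fun u => cosh (nu * u))).
    apply: continuous_comp; last exact: continuous_expR.
    apply: continuousN.
    by apply: (@continuousM _ R (fun=> x) (@cosh R)); [exact: cvg_cst|exact: ccosh].
  apply: continuous_comp; last exact: ccosh.
  by apply: continuousM; [exact: cvg_cst|exact: cvg_id].
rewrite ge0_integralZl_EFin ?(ltW c0) //; last first.
  move=> u _; rewrite lee_fin mulr_ge0 ?expR_ge0 //.
  by rewrite /cosh divr_ge0 // addr_ge0 ?expR_ge0.
rewrite fine_pmulEFin //; congr (_ * _).
rewrite /powR !gt_eqF // -expRD.
have -> : 2 * expR (nu * s) = expR (ln 2 + nu * s) by rewrite expRD lnK ?posrE.
by rewrite /s ln_div ?posrE //; congr expR; ring.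
Qed.

Lemma le_Rintegral_lbound_itv (f : R -> R) (a b y : R) : 0 < a -> a < b ->
  mu.-integrable `]0, +oo[ (EFin \o f) -> 0 <= y ->
  (forall t, 0 < t -> 0 <= f t) -> (forall t, a <= t <= b -> y <= f t) ->
  y * (b - a) <= \int[mu]_(t in `]0, +oo[) f t.
Proof.
move=> a0 ab intf y0 f0 yf.
rewrite -[leLHS]/(fine (y * (b - a))%:E) /Rintegral fine_le //.
  exact: integrable_fin_num.
have -> : ((y * (b - a))%:E = \int[mu]_(t in `[a, b]) y%:E)%E.
  by rewrite integral_cst //= lebesgue_measure_itv /= lte_fin ab -EFinD.
have abS : `[a, b] `<=` `]0, +oo[.
  move=> x /=; rewrite !in_itv /= andbT => /andP[+ _]; exact: lt_le_trans.
have mf : measurable_fun (`]0, +oo[ : set R) (EFin \o f).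
  by case/integrableP: intf.
apply: (@le_trans _ _ (\int[mu]_(t in `[a, b]) (f t)%:E)%E).
  by apply: ge0_le_integral => //; exact: measurable_funS mf.
apply: ge0_subset_integral => //.
by move=> t; rewrite /= in_itv /= andbT lee_fin => /f0.
Qed.

Lemma Gamma_gt0 nu : 0 < nu -> 0 < Gamma nu.
Proof.
move=> nu0; rewrite Gamma_weightE.
pose y : R := expR (- `|nu - 1| * ln 2 - 2).
have y0 : 0 < y by exact: expR_gt0.
have ln20 : 0 <= ln 2 :> R by rewrite ln_ge0 // ler1n.
apply: lt_le_trans (@le_Rintegral_lbound_itv _ 1 2 y _ _ _ _ _ _) => //.
- by rewrite mulr_gt0 // subr_gt0 ltr1n.
- by rewrite ltr1n.
- exact: integrable_gamma_weight.
- exact: ltW.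
- by move=> t _; exact: gamma_weight_ge0.
- move=> t /andP[t1 t2]; rewrite ler_expR mul0r subr0 lerB //.
  have lt0 : 0 <= ln t by rewrite ln_ge0.
  have lt2 : ln t <= ln 2 by rewrite ler_ln ?posrE // (lt_le_trans ltr01).
  rewrite mulNr -lerNl -mulNr.
  apply: (@le_trans _ _ (`|nu - 1| * ln t)); last by rewrite ler_wpM2l.
  by rewrite ler_wpM2r // lerNl lerNnormlW.
Qed.

(** This also holds at r = 0, where the integral is Gamma(nu). *)
Lemma kappa_weightE sigma nu r : 0 < nu -> 0 <= r ->
  kappa sigma nu r = sigma ^+ 2 / Gamma nu *
    \int[mu]_(t in `]0, +oo[) gamma_weight nu (nu * r ^+ 2 / 2) t.
Proof.
move=> nu0 r0; rewrite /kappa; case: eqP => [->|/eqP rn0].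
  rewrite expr0n mulr0 mul0r -Gamma_weightE divfK // gt_eqF //.
  exact: Gamma_gt0.
have rgt0 : 0 < r by rewrite lt_neqAle eq_sym rn0.
have z0 : 0 < Num.sqrt (2 * nu) * r by rewrite mulr_gt0 // sqrtr_gt0 mulr_gt0.
have -> : nu * r ^+ 2 / 2 = (Num.sqrt (2 * nu) * r) ^+ 2 / 4.
  by rewrite exprMn sqr_sqrtr ?mulr_ge0 ?(ltW nu0) //; field.
by rewrite -besselK_weightE //; ring.
Qed.

End MaternMixture.

(** * The quadratic form of the extended covariance matrix *)

Lemma Rintegral_sum d (T : measurableType d) (R : realType)
    (mu : {measure set T -> \bar R}) (I : Type) (r : seq I) (D : set T)
    (F : I -> T -> R) :
  measurable D -> (forall i, mu.-integrable D (EFin \o F i)) ->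
  mu.-integrable D (EFin \o (fun t => \sum_(i <- r) F i t)) /\
  \int[mu]_(t in D) (\sum_(i <- r) F i t) = \sum_(i <- r) \int[mu]_(t in D) F i t.
Proof.
move=> mD intF; elim: r => [|i r [IH1 IH2]].
  under eq_fun do rewrite big_nil.
  rewrite big_nil; split; last by rewrite Rintegral_cst // mul0r.
  exact: integrable0.
have e : (fun t => \sum_(i <- i :: r) F i t) =
         (fun t => F i t + \sum_(i <- r) F i t).
  by apply/funext => t; rewrite big_cons.
rewrite e big_cons; split; last by rewrite RintegralD // IH2.
by apply: (eq_integrable mD _ _ _ (integrableD mD (intF i) IH1)).
Qed.

Section QuadraticForm.
Local Open Scope classical_set_scope.
Variable R : realType.
Notation mu := (@lebesgue_measure R).

Lemma phi_cdist (m k k' : nat) (h : R) : 0 < h -> (0 < m)%N ->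
  (k < 2 * m)%N -> (k' < 2 * m)%N ->
  phi (m%:R * h) (h * (k%:R - k'%:R)) = h * (cdist (2 * m) k k')%:R.
Proof.
move=> h0 m0 km km'.
have l0 : 0 < m%:R * h by rewrite mulr_gt0 // ltr0n.
have pos n : (n < 2 * m)%N ->
    phi (m%:R * h) (h * n%:R) = h * (minn n (2 * m - n))%:R.
  move=> nm; have [nlem|mltn] := leqP n m.
    rewrite phi_left //; first by congr (_ * _%:R); lia.
    by rewrite mulr_ge0 ?(ltW h0) //= mulrC ler_pM2r // ler_nat.
  have nm2 : n%:R < 2 * m%:R :> R by rewrite -natrM ltr_nat.
  have mn : m%:R <= n%:R :> R by rewrite ler_nat ltnW.
  rewrite phi_right //; last by apply/andP; split; nra.
  have -> : minn n (2 * m - n) = (2 * m - n)%N by lia.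
  by rewrite natrB ?(ltnW nm) // natrM; ring.
have [kk|kk] := leqP k' k.
  rewrite -natrB // pos; last by lia.
  by rewrite /cdist; congr (_ * _%:R); lia.
rewrite -(phi_periodic l0).
have -> : h * (k%:R - k'%:R) + 2 * (m%:R * h) = h * (2 * m - (k' - k))%:R.
  rewrite natrB; last by lia.
  by rewrite natrB ?(ltnW kk) // natrM; ring.
rewrite pos; last by lia.
by rewrite /cdist; congr (_ * _%:R); lia.
Qed.

Lemma ln_le_sub1 (x : R) : 0 < x -> ln x <= x - 1.
Proof.
by move=> x0; have := expR_ge1Dx (ln x); rewrite lnK ?posrE //; lra.
Qed.

Lemma matern_entry (d m : nat) (h0 l lambda nu sigma : R)
    (k k' : multi_index d m) :
  0 < h0 -> (0 < m)%N -> l = m%:R * h0 -> 0 < nu -> 0 < lambda ->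
  rho_ext l sigma nu lambda (h0 *: \row_(i < d) ((k i)%:R - (k' i)%:R)) =
  sigma ^+ 2 / Gamma nu * \int[mu]_(t in `]0, +oo[)
    (gamma_weight nu 0 t * \prod_(i < d)
      gauss_kernel (2 * m) (nu * h0 ^+ 2 / (2 * lambda ^+ 2) / t) (k i) (k' i)).
Proof.
move=> h00 m0 -> nu0 lam0.
rewrite /rho_ext /rho kappa_weightE //; last first.
  by rewrite divr_ge0 ?(ltW lam0) // /norm2 sqrtr_ge0.
congr (_ * _); apply: eq_Rintegral => t _.
have -> : nu * (norm2 (\row_i phi (m%:R * h0)
     ((h0 *: \row_i0 ((k i0)%:R - (k' i0)%:R)) 0 i)) / lambda) ^+ 2 / 2 =
  \sum_(i < d) nu * h0 ^+ 2 / (2 * lambda ^+ 2) * (cdist (2 * m) (k i) (k' i))%:R ^+ 2.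
  rewrite /norm2 expr_div_n sqr_sqrtr; last by apply: sumr_ge0 => i _; exact: sqr_ge0.
  rewrite -mulr_sumr.
  have -> : \sum_(i < d) (\row_i phi (m%:R * h0)
     ((h0 *: \row_i0 ((k i0)%:R - (k' i0)%:R)) 0 i)) 0 i ^+ 2 =
     h0 ^+ 2 * \sum_(i < d) (cdist (2 * m) (k i) (k' i))%:R ^+ 2.
    rewrite mulr_sumr; apply: eq_bigr => i _.
    by rewrite !mxE phi_cdist // exprMn.
  by field; rewrite gt_eqF.
rewrite /gamma_weight mul0r subr0 expRD; congr (_ * _).
rewrite mulr_suml -sumrN expR_sum; apply: eq_bigr => i _.
by rewrite /gauss_kernel; congr expR; ring.
Qed.

Lemma quad_form_integral (d m : nat) (h0 l lambda nu sigma : R)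
    (v : 'cV[R]_#|multi_index d m|) :
  0 < h0 -> (0 < m)%N -> l = m%:R * h0 -> 0 < nu -> 0 < lambda ->
  let w (k : multi_index d m) := v (enum_rank k) 0 in
  let f t := gamma_weight nu 0 t *
    gauss_form (nu * h0 ^+ 2 / (2 * lambda ^+ 2) / t) w in
  mu.-integrable `]0, +oo[ (EFin \o f) /\
  (v^T *m R_ext d m h0 l sigma nu lambda *m v) 0 0 =
  sigma ^+ 2 / Gamma nu * \int[mu]_(t in `]0, +oo[) f t.
Proof.
move=> h00 m0 lE nu0 lam0 w f.
pose A := nu * h0 ^+ 2 / (2 * lambda ^+ 2).
have A0 : 0 <= A by rewrite divr_ge0 // mulr_ge0 ?sqr_ge0 ?(ltW nu0).
pose g (k k' : multi_index d m) t := gamma_weight nu 0 t * \prod_(i < d)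
      gauss_kernel (2 * m) (A / t) (k i) (k' i).
have gE k k' : g k k' =
    gamma_weight nu (A * \sum_(i < d) (cdist (2 * m) (k i) (k' i))%:R ^+ 2).
  apply/funext => t; rewrite /g /gamma_weight mul0r subr0 [in RHS]expRD.
  congr (_ * _); rewrite [A * \sum_(i < d) _]mulr_sumr mulr_suml -sumrN expR_sum.
  by apply: eq_bigr => i _; rewrite /gauss_kernel; congr expR; ring.
have intg k k' : mu.-integrable `]0, +oo[ (EFin \o g k k').
  rewrite gE; apply: integrable_gamma_weight => //.
  by rewrite mulr_ge0 // sumr_ge0 // => i _; exact: sqr_ge0.
have intwg k k' : mu.-integrable `]0, +oo[ (EFin \o (fun t => w k * w k' * g k k' t)).
  by apply: (eq_integrable _ _ _ _ (integrableZl _ (w k * w k') (intg k k'))).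
have fE : f = fun t => \sum_k \sum_k' w k * w k' * g k k' t.
  apply/funext => t; rewrite /f /gauss_form mulr_sumr; apply: eq_bigr => k _.
  by rewrite mulr_sumr; apply: eq_bigr => k' _; rewrite /g; ring.
have int1 k : mu.-integrable `]0, +oo[
      (EFin \o (fun t => \sum_k' w k * w k' * g k k' t)) /\
    \int[mu]_(t in `]0, +oo[) (\sum_k' w k * w k' * g k k' t) =
    \sum_k' \int[mu]_(t in `]0, +oo[) (w k * w k' * g k k' t).
  by apply: Rintegral_sum => //; exact: intwg.
have [int2 E2] : mu.-integrable `]0, +oo[
      (EFin \o (fun t => \sum_k \sum_k' w k * w k' * g k k' t)) /\
    \int[mu]_(t in `]0, +oo[) (\sum_k \sum_k' w k * w k' * g k k' t) =
    \sum_k \int[mu]_(t in `]0, +oo[) (\sum_k' w k * w k' * g k k' t).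
  by apply: Rintegral_sum => // k; exact: (int1 k).1.
rewrite fE; split; first exact: int2.
have Mkk (k k' : multi_index d m) :
    R_ext d m h0 l sigma nu lambda (enum_rank k) (enum_rank k') =
    sigma ^+ 2 / Gamma nu * \int[mu]_(t in `]0, +oo[) g k k' t.
  by rewrite mxE /= !enum_rankK matern_entry.
rewrite E2 mxE (reindex _ (onW_bij _ (@enum_rank_bij _))) /=.
transitivity (\sum_k' \sum_k sigma ^+ 2 / Gamma nu *
    (w k * w k' * \int[mu]_(t in `]0, +oo[) g k k' t)).
  apply: eq_bigr => k' _.
  rewrite mxE mulr_suml (reindex _ (onW_bij _ (@enum_rank_bij _))) /=.
  by apply: eq_bigr => k _; rewrite mxE Mkk /w; ring.
rewrite exchange_big mulr_sumr /=; apply: eq_bigr => k _.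
rewrite (int1 k).2 mulr_sumr; apply: eq_bigr => k' _; congr (_ * _).
by rewrite RintegralZl.
Qed.

End QuadraticForm.

(** * Positivity of the mixture *)

Section Positivity.
Local Open Scope classical_set_scope.
Variable R : realType.
Notation mu := (@lebesgue_measure R).

Lemma Rintegral_oy_expRN (b : R) : 0 < b ->
  mu.-integrable `]0, +oo[ (EFin \o (fun t => expR (- b * t))) /\
  \int[mu]_(t in `]0, +oo[) expR (- b * t) = b^-1.
Proof.
move=> b0.
have mexp (D : set R) := @measurable_expRM R (- b) D.
have E : (\int[mu]_(t in `]0%R, +oo[) (expR (- b * t))%:E = (b^-1)%:E)%E.
  rewrite integral_itv_obnd_cbnd; last exact: mexp.
  exact: integral_expRN.
split; last by rewrite /Rintegral E.
apply/integrableP; split; first exact: mexp.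
rewrite (_ : (\int[mu]_(x in _) _)%E = (b^-1)%:E) ?ltry // -E.
by apply: eq_integral => t _; rewrite /= ger0_norm ?expR_ge0.
Qed.

Lemma ln_le_div (x a : R) : 0 < x -> 0 < a -> ln x <= x / a + ln a - 1.
Proof.
move=> x0 a0; have := ln_le_sub1 (divr_gt0 x0 a0).
by rewrite ln_div ?posrE //; lra.
Qed.

(** The hypothesis s^2 = 2 A m^2 is where the geometric mean s of t and 2 A m^2/t
    enters: exp(-t - A m^2/t) <= exp(-t/2 - s). For t > T the factor t^(nu-1) is
    at most t^nu/T, and t^nu <= (4 nu)^nu e^(t/4), which leaves e^(-t/4) to
    integrate. For T/2 <= t <= T the weight is at least (T/2)^nu e^(-T)/T. *)
Lemma gauss_mixture_gt0 (d m : nat) (A nu s : R) (w : {ffun 'I_d -> 'I_(2 * m)} -> R) :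
  let f t := gamma_weight nu 0 t * gauss_form (A / t) w in
  let D : R := d%:R * (4 * m)%:R * ((2 * m) ^ d)%:R in
  let T := A / (6 * d)%:R in
  (0 < d)%N -> (0 < m)%N -> 0 < nu -> 0 < A -> s ^+ 2 = 2 * A * m%:R ^+ 2 ->
  0 < \sum_k w k ^+ 2 ->
  mu.-integrable `]0, +oo[ (EFin \o f) ->
  ln (16 * D) + nu * ln (4 * nu) - ln T + T - nu * ln (T / 2) < s ->
  0 < \int[mu]_(t in `]0, +oo[) f t.
Proof.
move=> f D T d0 m0 nu0 A0 sE S0 intf lns.
set S := \sum_k w k ^+ 2 in S0.
have d0R : 0 < (6 * d)%:R :> R by rewrite ltr0n muln_gt0.
have T0 : 0 < T by rewrite divr_gt0.
have D0 : 0 < D by rewrite !mulr_gt0 // ltr0n ?muln_gt0 // expn_gt0 muln_gt0 m0.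
pose y : R := expR (nu * ln (T / 2) - T - ln T).
pose b : R := D * expR (nu * ln (4 * nu) - ln T - s).
have y0 : 0 < y by exact: expR_gt0.
have b0 : 0 < b by rewrite mulr_gt0 ?expR_gt0.
have f_ge_half t : 0 < t -> t <= T -> gamma_weight nu 0 t * (S / 2) <= f t.
  move=> t0 tT; rewrite ler_wpM2l ?gamma_weight_ge0 //.
  apply: gauss_form_ge_half => //.
  by rewrite ler_pdivlMr // mulrC -ler_pdivlMr.
have f_ge_neg t : 0 < t -> - (S * b * expR (- 4^-1 * t)) <= f t.
  move=> t0; have [tT|Tt] := leP t T.
    apply: le_trans (f_ge_half _ t0 tT).
    apply: (@le_trans _ _ 0).
      by rewrite oppr_le0 !mulr_ge0 ?(ltW S0) ?(ltW b0) ?expR_ge0.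
    by rewrite mulr_ge0 ?gamma_weight_ge0 ?divr_ge0 ?(ltW S0).
  have At0 : 0 <= A / t by rewrite divr_ge0 ?ltW.
  have := ler_wpM2l (gamma_weight_ge0 nu 0 t) (gauss_form_ge w m0 At0).
  apply: le_trans; rewrite mulrN lerN2 -/S.
  have -> : gamma_weight nu 0 t * (d%:R * ((4 * m)%:R * expR (- (A / t) * m%:R ^+ 2))
      * ((2 * m) ^ d)%:R * S) =
    S * D * (gamma_weight nu 0 t * expR (- (A / t) * m%:R ^+ 2)).
    by rewrite /D; ring.
  rewrite /b !mulrA -[leRHS]mulrA -[leLHS]mulrA.
  rewrite ler_wpM2l ?mulr_ge0 ?(ltW S0) ?(ltW D0) // /gamma_weight -!expRD ler_expR.
  have lnt : ln T <= ln t by rewrite ler_ln ?posrE // ltW.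
  have lnt4 : nu * ln t <= nu * ln (4 * nu) + t / 4.
    have nu4 : 0 < 4 * nu by rewrite mulr_gt0.
    have h := ln_le_div t0 nu4.
    have := ler_wpM2l (ltW nu0) h.
    have -> : nu * (t / (4 * nu) + ln (4 * nu) - 1) = t / 4 + nu * ln (4 * nu) - nu.
      by field; rewrite gt_eqF.
    lra.
  have amgm : s <= t / 2 + A / t * m%:R ^+ 2.
    rewrite -subr_ge0.
    have -> : t / 2 + A / t * m%:R ^+ 2 - s = (t - s) ^+ 2 / (2 * t).
      have -> : A / t * m%:R ^+ 2 = s ^+ 2 / (2 * t) by rewrite sE; field; rewrite gt_eqF.
      by field; rewrite gt_eqF.
    by rewrite divr_ge0 ?sqr_ge0 // mulr_ge0 // ltW.
  by rewrite mul0r; lra.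
(* A nonnegative integrand, whose integral is bounded below on [T/2, T] alone. *)
pose F t := f t + S * b * expR (- 4^-1 * t).
have V4 : 0 < 4^-1 :> R by rewrite invr_gt0.
have [inte E4] := Rintegral_oy_expRN V4.
have intSe : mu.-integrable `]0, +oo[ (EFin \o (fun t => S * b * expR (- 4^-1 * t))).
  by apply: (eq_integrable _ _ _ _ (integrableZl _ (S * b) inte)).
have intF : mu.-integrable `]0, +oo[ (EFin \o F).
  by apply: (eq_integrable _ _ _ _ (integrableD _ intf intSe)).
have EF : \int[mu]_(t in `]0, +oo[) F t = \int[mu]_(t in `]0, +oo[) f t + S * b * 4.
  by rewrite RintegralD // RintegralZl // E4 invrK.
have : y * (S / 2) * (T - T / 2) <= \int[mu]_(t in `]0, +oo[) F t.
  apply: le_Rintegral_lbound_itv => //.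
  - by rewrite divr_gt0.
  - by rewrite ltr_pdivrMr // mulr_natr mulr2n ltrDl.
  - by rewrite mulr_ge0 ?divr_ge0 ?(ltW S0) ?(ltW y0).
  - by move=> t t0; have := f_ge_neg t t0; rewrite /F; lra.
  move=> t /andP[t1 t2].
  have t0 : 0 < t by apply: lt_le_trans t1; rewrite divr_gt0.
  have : y <= gamma_weight nu 0 t.
    rewrite ler_expR mul0r subr0.
    have l1 : ln (T / 2) <= ln t by rewrite ler_ln ?posrE // divr_gt0.
    have l2 : ln t <= ln T by rewrite ler_ln ?posrE.
    have := ler_wpM2l (ltW nu0) l1; lra.
  have S2 : 0 <= S / 2 by rewrite divr_ge0 // ltW.
  move=> /(ler_wpM2r S2); have := f_ge_half t t0 t2.
  have : 0 <= S * b * expR (- 4^-1 * t).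
    by rewrite !mulr_ge0 ?(ltW S0) ?(ltW b0) ?expR_ge0.
  by rewrite /F; lra.
rewrite EF.
have key : 16 * b < y * T.
  have D16 : 0 < 16 * D by rewrite mulr_gt0.
  have DE0 z : 0 < 16 * D * expR z by rewrite pmulr_rgt0 ?expR_gt0.
  have yT0 : 0 < y * T by rewrite pmulr_rgt0.
  rewrite /b mulrA -ltr_ln ?posrE //.
  rewrite [ln (y * T)]lnM ?posrE // [ln (16 * D * _)]lnM ?posrE ?expR_gt0 //.
  by rewrite /y expRK expRK; lra.
have : 0 < S * (y * T - 16 * b) by apply: mulr_gt0 => //; rewrite subr_gt0.
by lra.
Qed.

End Positivity.

(** * The threshold *)

Section Threshold.
Variable R : realType.

Definition log_const (d : nat) : R :=
  ln (64 * d)%:R + ln (24 * d)%:R + d.+1%:R * (ln 2 + ln (4 * d.+1)%:R).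

(** Collects the coefficients of nu log(lambda/h0) that remain in threshold_ineq
    after 1, log(lambda/h0) and nu have been bounded by multiples of it. *)
Definition C2_const (d : nat) : R :=
  2 * (2 * log_const d + 2 * (d + 3)%:R + ln (96 * d)%:R + 3).

Lemma ln_nat_ge0 n : 0 <= ln n%:R :> R.
Proof.
by case: n => [|n]; [rewrite ln0|rewrite ln_ge0 // ler1n].
Qed.

Lemma log_const_ge0 d : 0 <= log_const d.
Proof.
by rewrite /log_const !addr_ge0 ?mulr_ge0 ?addr_ge0 ?ln_nat_ge0.
Qed.

Lemma C2_const_ge d : 2 * Num.sqrt 2 <= C2_const d.
Proof.
have s2 : Num.sqrt 2 <= 2 :> R.
  by rewrite -[leRHS]ger0_norm // -sqrtr_sqr ler_sqrt // expr2; lra.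
have := log_const_ge0 d; have := ln_nat_ge0 (96 * d).
have : (0 : R) <= (d + 3)%:R by [].
by rewrite /C2_const; lra.
Qed.

(** Here X = lambda/h0 and L = l/lambda. The powers nu^nu in (4 nu)^nu and in
    (T/2)^nu cancel, which leaves nu log(96 d X^2); the polynomial factor in m = L X
    costs (d+1) log L <= L/4 + const, and sqrt(nu) >= 1/2 makes L/4 at
    most half of sqrt(nu) L. *)
Lemma threshold_ineq (d m : nat) (nu X L T : R) :
  (0 < d)%N -> (0 < m)%N -> m%:R = L * X -> 1 / 2 <= nu -> expR 1 <= X ->
  1 + C2_const d * Num.sqrt nu * ln (Num.max X (Num.sqrt nu)) <= L ->
  T = nu / (2 * X ^+ 2) / (6 * d)%:R ->
  ln (16 * (d%:R * (4 * m)%:R * ((2 * m) ^ d)%:R)) + nu * ln (4 * nu) - ln T + T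
    - nu * ln (T / 2) < Num.sqrt nu * L.
Proof.
move=> d0 m0 mE nu2 eX hL TE.
have dR : (1 : R) <= d%:R by rewrite ler1n.
have nu0 : 0 < nu by lra.
have X0 : 0 < X by apply: lt_le_trans eX; exact: expR_gt0.
have mR0 : 0 < m%:R :> R by rewrite ltr0n.
have L0 : 0 < L by move: mR0; rewrite mE pmulr_lgt0.
set x := ln X; have x1 : 1 <= x by rewrite /x -[leLHS]expRK ler_ln ?posrE ?expR_gt0.
have xM : x <= ln (Num.max X (Num.sqrt nu)).
  by rewrite ler_ln ?posrE ?lt_max ?X0 // le_max lexx.
have lnD : ln (16 * (d%:R * (4 * m)%:R * ((2 * m) ^ d)%:R)) =
    ln (64 * d)%:R + d%:R * ln 2 + d.+1%:R * (ln L + x) :> R.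
  have -> : 16 * (d%:R * (4 * m)%:R * ((2 * m) ^ d)%:R) =
      (64 * d)%:R * (2 ^+ d * (L * X) ^+ d.+1) :> R.
    by rewrite -mE !natrM natrX natrM exprMn exprS; ring.
  have d640 : 0 < (64 * d)%:R :> R by rewrite ltr0n muln_gt0.
  have LX0 : 0 < L * X by rewrite mulr_gt0.
  have p2 : 0 < 2 ^+ d :> R by rewrite exprn_gt0.
  have pLX : 0 < (L * X) ^+ d.+1 by rewrite exprn_gt0.
  rewrite lnM ?posrE // ?pmulr_rgt0 // lnM ?posrE // !lnXn // lnM ?posrE // addrA.
  by rewrite -[ln 2 *+ d]mulr_natl -[_ *+ d.+1]mulr_natl.
have T0 : 0 < T by rewrite TE !divr_gt0 ?mulr_gt0 ?exprn_gt0 // ltr0n muln_gt0.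
have lnT : ln T = ln nu - ln (12 * d)%:R - 2 * x.
  have -> : T = nu / ((12 * d)%:R * X ^+ 2).
    by rewrite TE !natrM; field; rewrite !gt_eqF //; lra.
  have d120 : 0 < (12 * d)%:R :> R by rewrite ltr0n muln_gt0.
  rewrite ln_div ?posrE ?mulr_gt0 ?exprn_gt0 // lnM ?posrE ?exprn_gt0 // lnXn //.
  by rewrite /x mulr2n; ring.
have lnT2 : nu * ln (4 * nu) - nu * ln (T / 2) = nu * (ln (96 * d)%:R + 2 * x).
  rewrite ln_div ?posrE // lnT lnM ?posrE //.
  have -> : (96 * d)%:R = 4 * 2 * (12 * d)%:R :> R by rewrite !natrM; ring.
  rewrite !lnM ?posrE ?mulr_gt0 // ?ltr0n ?muln_gt0 //; ring.
have lnnu : - ln nu <= ln 2.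
  have : ln 2^-1 <= ln nu by rewrite ler_ln ?posrE ?invr_gt0 //; lra.
  by rewrite lnV ?posrE //; lra.
have ln24 : ln (12 * d)%:R + ln 2 = ln (24 * d)%:R :> R.
  rewrite -lnM ?posrE ?ltr0n ?muln_gt0 //; congr ln.
  by rewrite !natrM; ring.
have Tnu : T <= nu.
  rewrite TE -mulrA -[leRHS]mulr1 ler_pM2l // -invfM invf_le1; last first.
    by rewrite !mulr_gt0 ?exprn_gt0 // ltr0n muln_gt0.
  have X1 : 1 <= X by apply: le_trans eX; rewrite -expR0 ler_expR.
  have : (1 : R) <= (6 * d)%:R by rewrite ler1n muln_gt0.
  by move: X1; nra.
have lnL : d.+1%:R * ln L <= L / 4 + d.+1%:R * ln (4 * d.+1)%:R.
  have d40 : 0 < (4 * d.+1)%:R :> R by rewrite ltr0n.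
  have := ler_wpM2l (ler0n R d.+1) (ln_le_div L0 d40).
  have -> : d.+1%:R * (L / (4 * d.+1)%:R + ln (4 * d.+1)%:R - 1) =
      L / 4 + d.+1%:R * ln (4 * d.+1)%:R - d.+1%:R :> R.
    by rewrite natrM; field; rewrite gt_eqF // ltr0n.
  have : (0 : R) <= d.+1%:R by [].
  lra.
have sq : Num.sqrt nu ^+ 2 = nu by rewrite sqr_sqrtr // ltW.
have s0 : 0 < Num.sqrt nu by rewrite sqrtr_gt0.
have s2 : 1 / 2 <= Num.sqrt nu by nra.
have E0 := log_const_ge0 d; have G0 := ln_nat_ge0 (96 * d).
pose K : R := 2 * log_const d + 2 * (d + 3)%:R + ln (96 * d)%:R + 3.
have K0 : 0 <= K by rewrite /K !addr_ge0 ?mulr_ge0.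
have sL : L / 4 + Num.sqrt nu / 2 + nu * x * K <= Num.sqrt nu * L.
  have h1 : 1 + 2 * K * Num.sqrt nu * x <= L.
    apply: le_trans hL; rewrite lerD2l ler_wpM2l // mulr_ge0 ?(ltW s0) //.
    by rewrite /C2_const mulr_ge0.
  have h2 := ler_wpM2l (ltW s0) h1.
  have h3 : Num.sqrt nu * (1 + 2 * K * Num.sqrt nu * x) =
     Num.sqrt nu + 2 * (Num.sqrt nu ^+ 2 * x * K) by ring.
  rewrite sq in h3.
  have h4 : L / 2 <= Num.sqrt nu * L by rewrite mulrC ler_wpM2r ?(ltW L0) //; lra.
  lra.
have nx1 : 1 <= 2 * (nu * x) by nra.
have nxn : nu <= nu * x by nra.
have nxx : x <= 2 * (nu * x) by nra.
have KE : nu * x * K = log_const d * (2 * (nu * x)) + (d.+1%:R + 2) * (2 * (nu * x)) +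
   ln (96 * d)%:R * (nu * x) + 2 * (nu * x) + nu * x.
  by rewrite /K natrD -natr1; ring.
have b1 := ler_wpM2l E0 nx1.
have b2 : (d.+1%:R + 2) * x <= (d.+1%:R + 2) * (2 * (nu * x)).
  by rewrite ler_wpM2l // addr_ge0.
have b3 := ler_wpM2l G0 nxn.
have ln20 := ln_nat_ge0 2.
have lcE : log_const d = ln (64 * d)%:R + ln (24 * d)%:R + d.+1%:R * ln 2
  + d.+1%:R * ln (4 * d.+1)%:R by rewrite /log_const; ring.
have d1 : d.+1%:R * ln 2 = d%:R * ln 2 + ln 2 :> R by rewrite -natr1; ring.
rewrite lnD lnT.
have -> : forall a b c : R, a + nu * ln (4 * nu) - b + c - nu * ln (T / 2) =
   a - b + c + (nu * ln (4 * nu) - nu * ln (T / 2)) by move=> *; ring.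
rewrite lnT2.

lra.
Qed.

End Threshold.

(** * Positive definiteness *)

Lemma R_ext_sym (R : realType) (d m : nat) (h0 l lambda nu sigma : R) :
  0 < h0 -> (0 < m)%N -> l = m%:R * h0 -> 0 < nu -> 0 < lambda ->
  (R_ext d m h0 l sigma nu lambda)^T = R_ext d m h0 l sigma nu lambda.
Proof.
move=> h00 m0 lE nu0 lam0; apply/matrixP => a b; rewrite !mxE /= !matern_entry //.
congr (_ * _); apply: eq_Rintegral => t _; congr (_ * _).
by apply: eq_bigr => i _; rewrite gauss_kernelC.
Qed.

Theorem theorem2p9 (R : realType) (d : nat) (hd : (1 <= d)%N) :
  exists C1 C2 : R, 0 < C1 /\ 2 * Num.sqrt 2 <= C2 /\
    forall (m0 m : nat) (h0 l lambda nu sigma : R),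
      (1 <= m0)%N -> h0 = 1 / m0%:R ->
      (m0 <= m)%N -> l = m%:R * h0 -> 1 <= l ->
      0 < sigma ^+ 2 -> 1 / 2 <= nu -> 0 < lambda -> lambda <= 1 ->
      h0 / lambda <= expR (-1) ->
      C1 + C2 * Num.sqrt nu * ln (Num.max (lambda / h0) (Num.sqrt nu))
        <= l / lambda ->
      posdefmx (R_ext d m h0 l sigma nu lambda).
Proof.
exists 1, (C2_const R d); split=> //; split; first exact: C2_const_ge.
move=> m0 m h0 l lambda nu sigma m01 h0E m0m lE _ sigma0 nu2 lam0 _ h0lam hL.
have h00 : 0 < h0 by rewrite h0E divr_gt0 // ltr0n.
have mgt0 : (0 < m)%N by exact: leq_trans m01 m0m.
have nu0 : 0 < nu by lra.
split; first exact: R_ext_sym.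
move=> v v0.
have [intf ->] := quad_form_integral sigma v h00 mgt0 lE nu0 lam0.
apply: mulr_gt0; first by rewrite divr_gt0 // Gamma_gt0.
have eX : expR 1 <= lambda / h0.
  rewrite -[leRHS]invrK invf_div -[leLHS]invrK -expRN lef_pV2 // posrE ?expR_gt0 //.
  by rewrite divr_gt0.
have mE : m%:R = l / lambda * (lambda / h0).
  by rewrite lE; field; rewrite !gt_eqF.
apply: (@gauss_mixture_gt0 _ _ _ _ _ (Num.sqrt nu * (l / lambda))) => //.
- by rewrite divr_gt0 ?mulr_gt0 ?exprn_gt0.
- rewrite exprMn sqr_sqrtr ?(ltW nu0) // lE.
  by field; rewrite gt_eqF.
- have [k vk] : exists k, v k 0 != 0.
    apply/existsP; apply: contraNT v0 => /existsPn h; apply/eqP/matrixP => i j.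
    by rewrite ord1 mxE; apply/eqP; have := h i; rewrite negbK.
  rewrite (bigD1 (enum_val k)) //= enum_valK ltr_wpDr //.
    by apply: sumr_ge0 => ? _; exact: sqr_ge0.
  by rewrite exprn_even_gt0.
- apply: threshold_ineq hL _ => //.
  by congr (_ / _); field; rewrite !gt_eqF.
Qed.
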